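(* Let $p^0,n^0,\rho^f\in\mathcal{C}$ be real grid functions with $\langle p^0-n^0+\rho^f,1\rangle_h=0$, let $\epsilon>0$, and let $\tau>0$ be arbitrary. Let $(p^k,n^k,\phi^k)_{k\ge 0}$ be the solution of the ETD1 scheme with time step $\tau$. Then for every $k\ge 0$, $$\langle p^{k+1},1\rangle_h=\langle p^{k},1\rangle_h=\cdots=\langle p^0,1\rangle_h=:M_p,$$ and $$\langle n^{k+1},1\rangle_h=\langle n^{k},1\rangle_h=\cdots=\langle n^0,1\rangle_h=:M_n.$$
   Context: Let $L>0$, $N\in\mathbb{Z}^+$, $h=L/N$. $\mathcal{C}$ denotes the space of real grid functions $u=(u_{i,j})_{i,j\in\mathbb{Z}}$ that are $N$-periodic in each index (an $N^2$-dimensional space). The discrete inner product is $\langle u,v\rangle_h=h^2\sum_{i,j=1}^N u_{i,j}v_{i,j}$, and $1$ denotes the constant grid function. The discrete Laplacian is $(\Delta_h u)_{i,j}=\frac1{h^2}(u_{i+1,j}+u_{i-1,j}+u_{i,j+1}+u_{i,j-1}-4u_{i,j})$. For $f\in\mathcal{C}$ with $\langle f,1\rangle_h=0$, $(-\epsilon^2\Delta_h)^{-1}f$ denotes the unique $\phi\in\mathcal{C}$ with $-\epsilon^2\Delta_h\phi=f$ and $\langle\phi,1\rangle_h=0$. For $\phi\in\mathcal{C}$, the linear operator $\mathcal{L}_h[\phi]:\mathcal{C}\to\mathcal{C}$ is $$(\mathcal{L}_h[\phi]u)_{i,j}=\frac1{h^2}\sum_{(i',j')}\frac{2e^{\phi_{i',j'}}e^{\phi_{i,j}}}{e^{\phi_{i',j'}}+e^{\phi_{i,j}}}\left(\frac{u_{i',j'}}{e^{\phi_{i',j'}}}-\frac{u_{i,j}}{e^{\phi_{i,j}}}\right),$$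 the sum being over the four neighbours $(i',j')\in\{(i+1,j),(i-1,j),(i,j+1),(i,j-1)\}$. It discretizes $\nabla\cdot(e^{\phi}\nabla(u/e^{\phi}))$. ETD1 scheme (first-order exponential time differencing scheme for the Poisson–Nernst–Planck equations): given $p^0,n^0$, set $\phi^0=(-\epsilon^2\Delta_h)^{-1}(p^0-n^0+\rho^f)$, and for $k\ge0$ $$p^{k+1}=e^{\tau\mathcal{L}_h[-\phi^k]}p^k,\qquad n^{k+1}=e^{\tau\mathcal{L}_h[\phi^k]}n^k,\qquad \phi^{k+1}=(-\epsilon^2\Delta_h)^{-1}(p^{k+1}-n^{k+1}+\rho^f),$$ where $e^{(\cdot)}$ of an operator is the operator exponential. The scheme is well defined because $p^k-n^k+\rho^f$ has zero mean for every $k$. *)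

(* Defs.v *)
From HB Require Import structures.
From mathcomp Require Import all_boot all_order all_algebra.
From mathcomp Require Import all_classical all_reals all_analysis.

Set Implicit Arguments.
Unset Strict Implicit.
Unset Printing Implicit Defensive.

Import Order.TTheory GRing.Theory Num.Theory.
Import numFieldNormedType.Exports.

Local Open Scope classical_set_scope.
Local Open Scope ring_scope.

Section GridFun.
Variables (R : realType) (N : nat).

Definition periodic : {pred (int -> int -> R^o)} :=
  fun u => `[< forall i j, u (i + N%:Z) j = u i j /\ u i (j + N%:Z) = u i j >].

Lemma periodic_submod_closed : submod_closed periodic.
Proof.
split=> [|a u v /asboolP pu /asboolP pv]; apply/asboolP=> i j //.
have [u1 u2] := pu i j; have [v1 v2] := pv i j.
by split; rewrite !fctE ?u1 ?u2 ?v1 ?v2.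
Qed.

HB.instance Definition _ :=
  GRing.isSubmodClosed.Build R (int -> int -> R^o) periodic
    periodic_submod_closed.

Record gridfun := GridFun {
  gridval :> int -> int -> R^o;
  gridvalP : gridval \in periodic }.

HB.instance Definition _ := [isSub for gridval].
HB.instance Definition _ := [Choice of gridfun by <:].
HB.instance Definition _ := [SubChoice_isSubLmodule of gridfun by <:].

Lemma gridP (u : gridfun) (i j : int) :
  u (i + N%:Z) j = u i j /\ u i (j + N%:Z) = u i j.
Proof. by have /asboolP := gridvalP u. Qed.

Lemma gridfunE (u v : gridfun) : (forall i j, u i j = v i j) -> u = v.
Proof. by move=> uv; apply/val_inj/funext => i; apply/funext => j. Qed.

Lemma gridDE (u v : gridfun) i j : (u + v) i j = u i j + v i j.
Proof. by []. Qed.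

Lemma gridZE (a : R) (u : gridfun) i j : (a *: u) i j = a * u i j.
Proof. by []. Qed.

Lemma one_periodic : (fun _ _ : int => 1 : R^o) \in periodic.
Proof. exact/asboolP. Qed.

Definition grid1 : gridfun := GridFun one_periodic.

Definition dot (h : R) (u v : gridfun) : R :=
  h ^+ 2 * \sum_(1 <= i < N.+1) \sum_(1 <= j < N.+1) u i%:Z j%:Z * v i%:Z j%:Z.

Definition neighbours (i j : int) : seq (int * int) :=
  [:: (i + 1, j); (i - 1, j); (i, j + 1); (i, j - 1)].

Lemma neighbours_sum_periodic (F : R -> R -> R -> R -> R) (u v : gridfun) :
  (fun i j => \sum_(q <- neighbours i j)
                F (u i j) (v i j) (u q.1 q.2) (v q.1 q.2) : R^o) \in periodic.
Proof.
apply/asboolP=> i j; rewrite /neighbours !big_cons !big_nil /=.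
rewrite !(addrAC _ N%:Z).
by split; rewrite ?(gridP u _ _).1 ?(gridP v _ _).1
                  ?(gridP u _ _).2 ?(gridP v _ _).2.
Qed.

Lemma lap_periodic (h : R) (u : gridfun) :
  (fun i j => 1 / h ^+ 2 * (u (i + 1) j + u (i - 1) j + u i (j + 1)
                             + u i (j - 1) - 4 * u i j) : R^o) \in periodic.
Proof.
apply/asboolP=> i j; rewrite !(addrAC _ N%:Z).
by split; rewrite ?(gridP u _ _).1 ?(gridP u _ _).2.
Qed.

Definition lap (h : R) (u : gridfun) : gridfun := GridFun (lap_periodic h u).

(* For nonzero h, eps and N, such a [phi] exists exactly when [f] has zero mean,
   and it is then unique; the value 0 returned otherwise is irrelevant. *)
Definition inv_lap (h eps : R) (f : gridfun) : gridfun :=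
  xget 0 [set phi | (- eps ^+ 2) *: lap h phi = f /\ dot h phi grid1 = 0].

Definition Lh_fun (h : R) (phi u : gridfun) (i j : int) : R^o :=
  1 / h ^+ 2 * \sum_(q <- neighbours i j)
    2 * expR (phi q.1 q.2) * expR (phi i j)
      / (expR (phi q.1 q.2) + expR (phi i j))
    * (u q.1 q.2 / expR (phi q.1 q.2) - u i j / expR (phi i j)).

Lemma Lh_periodic h phi u : Lh_fun h phi u \in periodic.
Proof.
apply/asboolP=> i j; rewrite /Lh_fun.
have /asboolP/(_ i j) := neighbours_sum_periodic
  (fun p0 u0 p1 u1 => 2 * expR p1 * expR p0 / (expR p1 + expR p0)
                      * (u1 / expR p1 - u0 / expR p0)) phi u.
by move=> [-> ->].
Qed.

Definition Lh (h : R) (phi u : gridfun) : gridfun :=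
  GridFun (Lh_periodic h phi u).

Lemma Lh_is_linear h phi : linear (Lh h phi).
Proof.
move=> a u v; apply: gridfunE => i j; rewrite gridDE gridZE.
rewrite [LHS]/(Lh_fun h phi (a *: u + v) i j) -[Lh h phi u i j]/(Lh_fun _ _ _ _ _).
rewrite -[Lh h phi v i j]/(Lh_fun _ _ _ _ _) /Lh_fun mulrCA -mulrDr.
congr (_ * _); rewrite big_distrr -big_split; apply: eq_bigr => q _.
rewrite !gridDE !gridZE [RHS]/= mulrCA -mulrDr; congr (_ * _).
by rewrite !mulrDl opprD addrACA mulrBr -!mulrA.
Qed.

HB.instance Definition _ h phi :=
  GRing.isLinear.Build R gridfun gridfun *:%R (Lh h phi) (Lh_is_linear h phi).

Definition exp_series (A : {linear gridfun -> gridfun}) (u : gridfun)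
    (i j : int) : R^nat :=
  series (fun k : nat => (k`!%:R)^-1 * (iter k A u) i j).

Lemma exp_op_periodic (A : {linear gridfun -> gridfun}) (u : gridfun) :
  (fun i j => lim (exp_series A u i j @ \oo) : R^o) \in periodic.
Proof.
apply/asboolP=> i j; split; congr (lim (_ @ \oo)); congr series.
  by apply/funext=> k; rewrite (gridP _ _ _).1.
by apply/funext=> k; rewrite (gridP _ _ _).2.
Qed.

(* The operator exponential [\sum_k A ^ k / k!]. The space of grid functions
   being finite-dimensional, convergence of this series of operators is the
   same as convergence of each entry of its value at each [u]. *)
Definition exp_op (A : {linear gridfun -> gridfun}) (u : gridfun) : gridfun :=
  GridFun (exp_op_periodic A u).

Record ETD1_solution (h eps tau : R) (rhof p0 n0 : gridfun)
    (p n phi : nat -> gridfun) : Prop := {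
  ETD1_p0 : p 0%N = p0;
  ETD1_n0 : n 0%N = n0;
  ETD1_phi0 : phi 0%N = inv_lap h eps (p0 - n0 + rhof);
  ETD1_pS : forall k, p k.+1 = exp_op (tau \*: Lh h (- phi k)) (p k);
  ETD1_nS : forall k, n k.+1 = exp_op (tau \*: Lh h (phi k)) (n k);
  ETD1_phiS : forall k,
    phi k.+1 = inv_lap h eps (p k.+1 - n k.+1 + rhof) }.

End GridFun.

Arguments grid1 {R N}.

(* Main.v *)
(** [Lh] is in divergence form: each term is an antisymmetric flux across an
    edge, so the sum of [Lh phi u] over a period telescopes to zero. Hence in
    [\sum_k A ^ k u / k!] only the term [k = 0] carries mass. Exchanging the
    limit of the series with the finite sum over the grid requires each entry
    to converge, which holds because [Lh] is bounded by [16 / h ^ 2] in the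
    maximum norm. *)
Require Import Defs.
From mathcomp Require Import all_boot all_order all_algebra.
From mathcomp Require Import all_classical all_reals all_analysis.
From mathcomp Require Import ring lra.
Import Order.TTheory GRing.Theory Num.Theory.
Import numFieldNormedType.Exports.
Local Open Scope ring_scope.

Section Mass.
Variables (R : realType) (N : nat).
Implicit Types (u v w phi : gridfun R N) (A : {linear gridfun R N -> gridfun R N}).

Lemma dotDl (h : R) u v w : dot h (u + v) w = dot h u w + dot h v w.
Proof.
rewrite /dot -mulrDr -big_split; congr (_ * _); apply: eq_bigr => i _.
by rewrite -big_split; apply: eq_bigr => j _; rewrite gridDE mulrDl.
Qed.

Lemma dotZl (h a : R) u w : dot h (a *: u) w = a * dot h u w.
Proof.
rewrite /dot mulrCA; congr (_ * _); rewrite big_distrr; apply: eq_bigr => i _.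
by rewrite [RHS]big_distrr; apply: eq_bigr => j _; rewrite gridZE -mulrA.
Qed.

(** One neighbour's share of [Lh], kept as a function of four reals so that antisymmetry and the
    bound become facts about numbers. *)
Definition flux (p0 u0 p1 u1 : R) : R :=
  2 * expR p1 * expR p0 / (expR p1 + expR p0) * (u1 / expR p1 - u0 / expR p0).

Lemma fluxC (p0 u0 p1 u1 : R) : flux p1 u1 p0 u0 = - flux p0 u0 p1 u1.
Proof.
by rewrite /flux -[in RHS]mulrN opprB (addrC (expR p1)) (mulrAC 2).
Qed.

(** The exponentials cancel: the flux is [2 * (a * u1 - b * u0) / (b + a)] with [a, b > 0], and both
    weights [a / (b + a)], [b / (b + a)] are at most 1. The bound is thus uniform in the
    potential. *)
Lemma flux_bound (p0 u0 p1 u1 B : R) :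
  `|u0| <= B -> `|u1| <= B -> `|flux p0 u0 p1 u1| <= 4 * B.
Proof.
move=> b0 b1; rewrite /flux; have := expR_gt0 p0; have := expR_gt0 p1.
move: (expR p0) (expR p1) => a b b_gt0 a_gt0.
have ab_gt0 : 0 < b + a by lra.
have -> : 2 * b * a / (b + a) * (u1 / b - u0 / a)
        = 2 * (a * u1 - b * u0) / (b + a).
  by field; rewrite !gt_eqF.
move: b0 b1; rewrite !ler_norml ler_pdivrMr // ler_pdivlMr //.
move=> /andP[? ?] /andP[? ?]; apply/andP; split; nra.
Qed.

Lemma Lh_flux (h : R) phi u i j : Lh h phi u i j = 1 / h ^+ 2 *
  \sum_(q <- neighbours i j) flux (phi i j) (u i j) (phi q.1 q.2) (u q.1 q.2).
Proof. by []. Qed.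

Lemma Lh_bound (h B : R) phi u : (forall i j, `|u i j| <= B) ->
  forall i j, `|Lh h phi u i j| <= 16 / h ^+ 2 * B.
Proof.
move=> uB i j; rewrite Lh_flux normrM ger0_norm ?divr_ge0 ?sqr_ge0 //.
(* The constant 16 is four neighbours times the flux bound 4. *)
have -> : 16 / h ^+ 2 * B = 1 / h ^+ 2 * (4 * B + (4 * B + (4 * B + 4 * B))).
  by ring.
rewrite ler_wpM2l ?divr_ge0 ?sqr_ge0 //.
rewrite /neighbours !big_cons big_nil addr0 /=.
do 3! (apply: le_trans (ler_normD _ _) _; apply: lerD; first exact: flux_bound).
exact: flux_bound.
Qed.

(** The sum telescopes to [F N - F 0]. *)
Lemma sum_period (F : int -> R) : (forall i, F (i + N%:Z) = F i) ->
  \sum_(1 <= i < N.+1) (F i%:Z - F (i%:Z - 1)) = 0.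
Proof.
move=> FP; rewrite big_add1 /= (telescope_sumr_eq (fun i : nat => F i%:Z)) //.
  by rewrite -[N%:Z]add0r FP subrr.
by move=> i _; rewrite -addn1 PoszD addrK.
Qed.

Lemma dot_Lh_grid1 (h : R) phi u : dot h (Lh h phi u) grid1 = 0.
Proof.
(* Fluxes across forward edges; the index to be telescoped comes last. By [fluxC], the flux to a
   backward neighbour is minus that neighbour's forward flux. *)
pose Fx j i := flux (phi i j) (u i j) (phi (i + 1) j) (u (i + 1) j).
pose Fy i j := flux (phi i j) (u i j) (phi i (j + 1)) (u i (j + 1)).
have LE i j : Lh h phi u i j * grid1 i j = 1 / h ^+ 2 *
    ((Fx j i - Fx j (i - 1)) + (Fy i j - Fy i (j - 1))).
  rewrite mulr1 Lh_flux; congr (_ * _).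
  rewrite /neighbours !big_cons big_nil addr0 /= /Fx /Fy !subrK -!fluxC.
  by rewrite !addrA.
rewrite /dot; apply/eqP; rewrite mulf_eq0; apply/orP; right; apply/eqP.
under eq_bigr do under eq_bigr do rewrite LE.
under eq_bigr do rewrite -big_distrr big_split /=.
rewrite -big_distrr big_split /= exchange_big /=.
rewrite !big1 ?addr0 ?mulr0 // => i _; apply: sum_period => j.
  by rewrite /Fy (addrAC j) !(gridP _ _ _).2.
by rewrite /Fx (addrAC j) !(gridP _ _ _).1.
Qed.

(** Reducing both indices modulo [N] leaves finitely many values, and the sum of their absolute
    values dominates each. *)
Lemma gridfun_bounded u : (0 < N)%N -> exists B, forall i j, `|u i j| <= B.
Proof.
move=> N_gt0.
have shift (f : int -> R) : (forall i, f (i + N%:Z) = f i) ->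
    forall i, exists a : 'I_N, f i = f a%:Z.
  move=> fP i; have fM (m : nat) k : f (k + m%:Z * N%:Z) = f k.
    by elim: m k => [|m IH] k; rewrite ?mul0r ?addr0 // -addn1 PoszD mulrDl
      mul1r addrA fP IH.
  have N0 : N%:Z != 0 by rewrite -lt0n.
  have ltN : (`|(i %% N%:Z)%Z| < N)%N.
    by rewrite -ltz_nat gez0_abs ?modz_ge0 // ltz_mod.
  exists (Ordinal ltN) => /=; rewrite gez0_abs ?modz_ge0 //.
  rewrite {1}(divz_eq i N%:Z) addrC.
  case: (i %/ N%:Z)%Z => m; first exact: fM.
  (* A negative quotient is undone by moving [m.+1] periods forward. *)
  by rewrite -[LHS](fM m.+1) NegzE mulNr subrK.
exists (\sum_(a < N) \sum_(b < N) `|u a%:Z b%:Z|) => i j.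
have [a ->] := shift (u^~ j) (fun k => (gridP u k j).1) i.
have [b ->] := shift (u a%:Z) (fun k => (gridP u a%:Z k).2) j.
rewrite (bigD1 a) //= (bigD1 b) //= -addrA lerDl.
by rewrite addr_ge0 // sumr_ge0 // => k _; rewrite sumr_ge0.
Qed.

(** Comparison with the scalar series of [B * expR c], since the iterates satisfy
    [|A^k u| <= c^k B]. *)
Lemma is_cvg_exp_series A (c : R) u i j : (0 < N)%N -> 0 <= c ->
  (forall v B, (forall i j, `|v i j| <= B) ->
     forall i j, `|A v i j| <= c * B) ->
  cvgn (exp_series A u i j).
Proof.
move=> N_gt0 c_ge0 Ac; have [B uB] := gridfun_bounded u N_gt0.
have iterB k : forall i j, `|iter k A u i j| <= c ^+ k * B.
  elim: k => [|k IH]; first by move=> a b; rewrite expr0 mul1r.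
  by rewrite exprS -mulrA; exact: Ac.
apply: normed_cvg; apply: (@series_le_cvg _ _ (fun k => B * exp_coeff c k)).
- by move=> k; exact: normr_ge0.
- move=> k; apply: mulr_ge0; last by rewrite exp_coeff_ge0.
  exact: le_trans (uB i j).
- move=> k; rewrite /= normrM ger0_norm ?invr_ge0 ?ler0n // exp_coeffE.
  by rewrite mulrCA ler_wpM2l ?invr_ge0 ?ler0n // mulrC.
- exact/is_cvg_seriesZ/is_cvg_series_exp_coeff.
Qed.

Lemma dot_exp_op (h : R) A (c : R) u : (0 < N)%N -> 0 <= c ->
  (forall v B, (forall i j, `|v i j| <= B) ->
     forall i j, `|A v i j| <= c * B) ->
  (forall v, dot h (A v) grid1 = 0) ->
  dot h (exp_op A u) grid1 = dot h u grid1.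
Proof.
move=> N_gt0 c_ge0 Ac A0.
pose P n := \sum_(k < n) (k`!%:R)^-1 *: iter k A u.
have PE n i j : P n i j = exp_series A u i j n.
  rewrite /exp_series /series /= big_mkord /P.
  elim: n => [|n IH]; first by rewrite !big_ord0.
  by rewrite !big_ord_recr -IH.
(* The index starts at 1 because [P 0] is the empty sum; the limit below is shifted accordingly. All
   terms after the first together form [A] of a single grid function. *)
have dotP n : dot h (P n.+1) grid1 = dot h u grid1.
  rewrite /P big_ord_recl /= fact0 invr1 scale1r.
  under eq_bigr do rewrite /bump /= add1n -linearZ /=.
  by rewrite -linear_sum dotDl A0 addr0.
have cvgP : (dot h (P n) grid1 @[n --> \oo] --> dot h (exp_op A u) grid1)%classic.
  apply: cvgMl_tmp; apply: cvg_big => [|i _]; first exact: add_continuous.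
  apply: cvg_big => [|j _]; first exact: add_continuous.
  apply: cvgMr_tmp; under eq_cvg do rewrite PE.
  exact: is_cvg_exp_series Ac.
move: cvgP; rewrite -cvg_shiftS; under eq_cvg do rewrite /= dotP.
by move=> cvgu; apply: (cvg_unique _ cvgu (cvg_cst _)).
Qed.

(** The potential is arbitrary, so this serves [p] with [- phi k] and [n] with [phi k]. *)
Lemma dot_exp_Lh (h tau : R) phi u : (0 < N)%N -> 0 <= tau ->
  dot h (exp_op (tau \*: Lh h phi) u) grid1 = dot h u grid1.
Proof.
move=> N_gt0 tau_ge0; apply: (@dot_exp_op _ _ (tau * (16 / h ^+ 2))) => //.
- by rewrite mulr_ge0 ?divr_ge0 ?sqr_ge0.
- move=> v B vB i j; rewrite [_ i j]gridZE normrM ger0_norm // -mulrA.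
  by rewrite ler_wpM2l // Lh_bound.
- by move=> v; rewrite [_ v]/(_ *: _) dotZl dot_Lh_grid1 mulr0.
Qed.

End Mass.

Theorem theorem1 (R : realType) (L : R) (N : nat) (h eps tau : R)
    (rhof p0 n0 : gridfun R N) (p n phi : nat -> gridfun R N)
    (L_gt0 : 0 < L) (N_gt0 : (0 < N)%N) (hE : h = L / N%:R)
    (eps_gt0 : 0 < eps) (tau_gt0 : 0 < tau)
    (neutral : dot h (p0 - n0 + rhof) grid1 = 0)
    (sol : ETD1_solution h eps tau rhof p0 n0 p n phi) :
  forall k : nat,
    (dot h (p k.+1) grid1 = dot h (p k) grid1
     /\ dot h (p k) grid1 = dot h p0 grid1)
    /\ (dot h (n k.+1) grid1 = dot h (n k) grid1
     /\ dot h (n k) grid1 = dot h n0 grid1).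
Proof.
have [pE nE _ pS nS _] := sol.
have massp k : dot h (p k.+1) grid1 = dot h (p k) grid1.
  by rewrite pS dot_exp_Lh // ltW.
have massn k : dot h (n k.+1) grid1 = dot h (n k) grid1.
  by rewrite nS dot_exp_Lh // ltW.
move=> k; split; split=> //; elim: k => [|k IH].
- by rewrite pE.
- by rewrite massp.
- by rewrite nE.
- by rewrite massn.
Qed.
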